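(* \textsc{Bounded-Density Vertex Deletion} can be solved in $O(n)$ time when the input graph is a tree on $n$ vertices.
   Context: All graphs are finite, simple and undirected. The density of a graph $H$ is $\rho(H)=|E(H)|/|V(H)|$ (the empty graph has density $0$), and $\rho^*(G)=\max_{H\subseteq G}\rho(H)$. \textsc{Bounded-Density Vertex Deletion}: given a graph $G$, an integer $k\ge 0$ and a rational $\tau_\rho\ge 0$, decide whether there is $S\subseteq V(G)$ with $|S|\le k$ such that $\rho^*(G-S)\le\tau_\rho$, where $G-S$ is the graph obtained by deleting the vertices in $S$ (and their incident edges). *)

(* Defs.v *)
From mathcomp Require Import all_boot all_order all_algebra.

Set Implicit Arguments.
Unset Strict Implicit.
Unset Printing Implicit Defensive.

Import Order.TTheory GRing.Theory Num.Theory.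

(** * Finite simple graphs with vertices in a finite type *)

Section Graphs.
Variable T : finType.

Definition is_graph (VE : {set T} * {set {set T}}) : bool :=
  [forall e in VE.2, (e \subset VE.1) && (#|e| == 2)].

Definition graph := {VE : {set T} * {set {set T}} | is_graph VE}.

Definition verts (G : graph) : {set T} := (val G).1.
Definition edges (G : graph) : {set {set T}} := (val G).2.

(* Irreflexive, since [set x; x] has only one element. *)
Definition adjacent (G : graph) : rel T :=
  fun x y => [set x; y] \in edges G.

(* Subgraphs need not be induced. *)
Definition subgraph (H G : graph) : bool :=
  (verts H \subset verts G) && (edges H \subset edges G).

Lemma delete_is_graph (G : graph) (S : {set T}) :
  is_graph (verts G :\: S, [set e in edges G | [disjoint e & S]]).
Proof.
apply/forall_inP => e; rewrite inE => /andP[eG eS].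
have /forall_inP/(_ _ eG)/andP[sub ->] := valP G.
by rewrite subsetD sub eS.
Qed.

Definition delete (G : graph) (S : {set T}) : graph :=
  exist (fun VE => is_graph VE) _ (delete_is_graph G S).

Definition connected (G : graph) : Prop :=
  verts G != set0 /\
  {in verts G &, forall x y, connect (adjacent G) x y}.

(* [ucycle] also accepts [::] and the back-and-forth walk [:: x; y] along an
   edge, which are not cycles of a simple graph. *)
Definition acyclic (G : graph) : Prop :=
  forall c : seq T, ucycle (adjacent G) c -> size c < 3.

Definition is_tree (G : graph) : Prop := connected G /\ acyclic G.

(* The empty graph has density 0 because 0 / 0 = 0 in [rat]. *)
Definition density (G : graph) : rat :=
  (#|edges G|%:R / #|verts G|%:R)%R.

Definition max_density (G : graph) : rat :=
  \big[Num.max/0%R]_(H : graph | subgraph H G) density H.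

Definition bounded_density_vertex_deletion
    (G : graph) (k : nat) (tau : rat) : Prop :=
  exists S : {set T},
    [/\ S \subset verts G, #|S| <= k & (max_density (delete G S) <= tau)%R].

End Graphs.

(** * Word RAM

   Registers and memory cells hold words, i.e. numbers below [2 ^ w];
   arithmetic wraps around, and every instruction costs one time unit.  The
   instruction set is a minimal one: there is neither multiplication, nor
   division, nor any bitwise operation. *)

Inductive instr : Type :=
| Const (r a : nat)       (* R[r] := a *)
| Add (r s t : nat)       (* R[r] := R[s] + R[t] *)
| Sub (r s t : nat)       (* R[r] := R[s] - R[t] *)
| Read (r s : nat)        (* R[r] := M[R[s]] *)
| Write (r s : nat)       (* M[R[r]] := R[s] *)
| Jump (l : nat)          (* goto l *)
| JumpLt (r s l : nat)    (* if R[r] < R[s] then goto l *)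
| Accept
| Reject.

Definition program := seq instr.

Definition update (f : nat -> nat) (i x : nat) : nat -> nat :=
  fun j => if j == i then x else f j.

(* [run w P t pc R M = Some b] iff [P], started at instruction [pc] with
   registers [R] and memory [M], halts with answer [b] after executing at most
   [t] instructions.  Leaving the program without [Accept] or [Reject] is not a
   valid way of halting. *)
Fixpoint run (w : nat) (P : program) (t pc : nat) (R M : nat -> nat)
    : option bool :=
  if t isn't t'.+1 then None else
  match onth P pc with
  | None => None
  | Some i =>
    match i with
    | Const r a => run w P t' pc.+1 (update R r (a %% 2 ^ w)) M
    | Add r s u => run w P t' pc.+1 (update R r ((R s + R u) %% 2 ^ w)) M
    | Sub r s u =>
        run w P t' pc.+1 (update R r ((R s + (2 ^ w - R u)) %% 2 ^ w)) M
    | Read r s => run w P t' pc.+1 (update R r (M (R s))) M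
    | Write r s => run w P t' pc.+1 R (update M (R r) (R s))
    | Jump l => run w P t' l R M
    | JumpLt r s l => run w P t' (if R r < R s then l else pc.+1) R M
    | Accept => Some true
    | Reject => Some false
    end
  end.

(* Initially the input occupies the first memory cells, and all the other
   cells and all the registers contain 0. *)
Definition decides_within (w : nat) (P : program) (t : nat) (input : seq nat)
    (A : Prop) : Prop :=
  exists b : bool,
    run w P t 0 (fun=> 0) (nth 0 input) = Some b /\ (b <-> A).

(* Number of bits sufficient for every number in the input and for the
   addresses of the input cells. *)
Definition input_bits (input : seq nat) : nat :=
  up_log 2 (size input + \max_(a <- input) a).

(** * Encoding of the instances *)

Definition adjacency_lists (n : nat) (G : graph 'I_n) (l : 'I_n -> seq 'I_n)
    : Prop :=
  forall v : 'I_n, uniq (l v) /\ l v =i adjacent G v.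

(* The words n, k and the numerator and denominator of tau in lowest terms,
   then the n + 1 offsets delimiting the adjacency lists in the array of
   neighbours, then this array, i.e. the concatenated adjacency lists. *)
Definition instance_encoding (n : nat) (l : 'I_n -> seq 'I_n) (k : nat)
    (tau : rat) : seq nat :=
  [:: n; k; `|numq tau|%N; `|denq tau|%N]
  ++ (0 :: scanl addn 0 [seq size (l v) | v <- enum 'I_n])
  ++ flatten [seq [seq val u | u <- l v] | v <- enum 'I_n].

(* Main.v *)
(** A subgraph of a forest with h > 0 vertices has at most h - 1 edges, with
    equality for trees.  Hence rho*(F) <= a / b, for a forest F, iff every
    component of F has size at most B, the largest h with (h - 1) b <= h a, and
    it is enough to delete vertices until all components have size at most B.
    Greedily: repeatedly cut off a leaf u with neighbour p, adding the component
    size stored at u to that of p; if the sum exceeds B, delete p.  Each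
    deletion exhibits a connected set of more than B vertices disjoint from the
    previous ones, so no solution has fewer deletions.

    Leaves are found in linear time without any queue: for each vertex store its
    remaining degree and the sum of its remaining neighbours (for a leaf, this
    sum is its neighbour), and for each vertex in turn follow the chain of
    leaves starting there. *)

Require Import Defs.
From mathcomp Require Import all_boot all_order all_algebra.
From mathcomp Require Import zify.

Set Implicit Arguments.
Unset Strict Implicit.
Unset Printing Implicit Defensive.

Import Order.TTheory GRing.Theory Num.Theory.

(** * Leaves and edge counts in forests *)

Section Forests.
Variables (T : finType) (G : graph T).
Implicit Types (x y u v : T) (X S : {set T}).

Lemma adjacentC : symmetric (adjacent G).
Proof. by move=> x y; rewrite /adjacent setUC. Qed.

Lemma card_edge e : e \in edges G -> #|e| = 2.
Proof. by move=> eG; have /forall_inP/(_ _ eG)/andP[_ /eqP] := valP G. Qed.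

Lemma edge_verts e : e \in edges G -> e \subset verts G.
Proof. by move=> eG; have /forall_inP/(_ _ eG)/andP[] := valP G. Qed.

Lemma edgeP e : e \in edges G -> exists x y, adjacent G x y /\ e = [set x; y].
Proof.
move=> eG; have /eqP/cards2P[x [y [xy exy]]] := card_edge eG.
by exists x, y; rewrite /adjacent -exy.
Qed.

Lemma adjacentxx x : adjacent G x x = false.
Proof.
by apply/negP=> /card_edge; rewrite setUid cards1.
Qed.

Definition edges_in X : {set {set T}} := [set e in edges G | e \subset X].

Hypothesis acG : acyclic G.

Lemma acyclic_leaf X : X != set0 ->
  exists2 x, x \in X & #|[set y in X | adjacent G x y]| <= 1.
Proof.
move=> X0; have [/existsP[x /andP[]]|] :=
  boolP [exists x, (x \in X) && (#|[set y in X | adjacent G x y]| <= 1)].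
  by exists x.
rewrite negb_exists => /forallP H.
have {}H x : x \in X -> 1 < #|[set y in X | adjacent G x y]|.
  by move=> xX; have := H x; rewrite xX /= -ltnNge.
(* A maximal path inside X closes up into a cycle. *)
have /set0Pn[x0 x0X] := X0.
suff F m x p : #|X| - size p = m -> path (adjacent G) x p -> uniq (x :: p) ->
    all (mem X) (x :: p) -> False.
  by case: (@F _ x0 [::] erefl) => //=; rewrite x0X.
elim/ltn_ind: m x p => m IH x p mE pxp upx apx.
have szp : size p < #|X|.
  rewrite -[(size p).+1]/(size (x :: p)) -(card_uniqP upx) subset_leq_card //.
  by apply/subsetP=> z /(allP apx).
have ext y : y \in X -> adjacent G x y -> y \in p.
  move=> yX xy; apply/negPn/negP=> yp.
  apply: (IH _ _ y (x :: p) erefl) => //=.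
  - by rewrite -mE /=; lia.
  - by rewrite adjacentC xy.
  - rewrite inE negb_or yp andbT -(cons_uniq x p) upx andbT.
    by apply/eqP=> yx; move: xy; rewrite yx adjacentxx.
  - by rewrite yX.
have xX : x \in X by move: apx => /= /andP[].
have /card_gt1P[y1 [y2 [/setIdP[y1X xy1] /setIdP[y2X xy2] y12]]] := H _ xX.
(* Of two neighbours of [x] in [X], one is not the next vertex of the path. It lies on the path by
   [ext], and the cycle it closes has at least three vertices. *)
have [y yX [xy yh]] : exists2 y, y \in X & adjacent G x y /\ y != head x p.
  have [e|ne] := eqVneq y1 (head x p); last by exists y1.
  by exists y2 => //; split=> //; rewrite -e eq_sym.
have yp := ext _ yX xy.
case/splitPr: yp yh pxp upx {IH mE apx szp ext} => p1 p2 yh.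
rewrite cat_path -cat_cons cat_uniq /= => /andP[px1 /andP[lx _]] /and3P[ux1 nh _].
suff : size (x :: rcons p1 y) < 3.
  by case: p1 yh {px1 lx ux1 nh} => [|a p1] /=; rewrite ?eqxx // size_rcons.
apply: acG; apply/andP; split.
  by rewrite /= rcons_path rcons_path last_rcons px1 lx adjacentC.
move: nh; rewrite negb_or inE negb_or => /andP[/andP[yx yp1] _].
rewrite /= mem_rcons inE negb_or eq_sym yx rcons_uniq yp1 /=.
by case/andP: ux1 => -> ->.
Qed.

Lemma acyclic_ind (Q : {set T} -> Prop) : Q set0 ->
  (forall X x, x \in X -> #|[set y in X | adjacent G x y]| <= 1 ->
     Q (X :\ x) -> Q X) -> forall X, Q X.
Proof.
move=> Q0 QS X; move: {2}#|X| (erefl #|X|) => m.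
elim: m X => [|m IH] X Xm; first by rewrite (cards0_eq Xm).
have [|x xX x1] := @acyclic_leaf X; first by rewrite -card_gt0 Xm.
by apply: (QS _ x) => //; apply: IH; rewrite (cardsD1 x) xX in Xm; case: Xm.
Qed.

(** Peeling off a vertex with at most one neighbour in [X] loses at most one edge. *)
Lemma acyclic_card_edges_in X : X != set0 -> #|edges_in X| < #|X|.
Proof.
elim/acyclic_ind: X => [|X x xX x1 IH _]; first by rewrite eqxx.
have sub : edges_in X \subset
    edges_in (X :\ x) :|: [set [set x; y] | y in [set y in X | adjacent G x y]].
  apply/subsetP=> e; rewrite !inE => /andP[eG eX].
  have [xe|xe] := boolP (x \in e); last first.
    by rewrite eG subsetD1 eX xe.
  apply/orP; right; have [a [b [ab e2]]] := edgeP eG.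
  move: xe; rewrite e2 !inE => /orP[]/eqP->.
    apply/imsetP; exists b => //; rewrite inE ab andbT.
    by apply: (subsetP eX); rewrite e2 !inE eqxx orbT.
  apply/imsetP; exists a; last by rewrite setUC.
  rewrite inE adjacentC ab andbT.
  by apply: (subsetP eX); rewrite e2 !inE eqxx.
have le1 := leq_trans (leq_imset_card (fun y => [set x; y]) _) x1.
have := leq_trans (subset_leq_card sub) (leq_card_setU _ _).
(* The induction hypothesis needs a nonempty set, so a single vertex is treated apart. *)
have [X0|X0] := eqVneq (X :\ x) set0; last first.
  move=> H; have := leq_trans H (leq_add (leqnn _) le1); have := IH X0.
  by rewrite (cardsD1 x X) xX; lia.
have -> : edges_in X = set0; last by rewrite cards0 => _; apply/card_gt0P; exists x.
apply/setP=> e; rewrite !inE; apply/negP=> /andP[eG eX].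
have := subset_leq_card eX; rewrite (card_edge eG) (cardsD1 x X) X0 cards0.
by case: (x \in X).
Qed.

(** Peeling off a vertex of degree at most 1 lowers the sum by at most 2. For the whole vertex set
    this bounds the total length of the adjacency lists. *)
Lemma acyclic_sum_degrees X :
  \sum_(x in X) #|[set y in X | adjacent G x y]| <= 2 * #|X|.
Proof.
elim/acyclic_ind: X => [|X x xX x1 IH]; first by rewrite big_set0.
rewrite (bigD1 x) //=.
have e z : z \in X -> z != x -> #|[set y in X | adjacent G z y]| =
    #|[set y in X :\ x | adjacent G z y]| + (adjacent G x z).
  move=> zX zx; rewrite (cardsD1 x) inE xX adjacentC addnC; congr (_ + _).
  by apply: eq_card => y; rewrite !inE andbA.
under eq_bigr => z /andP[zX zx] do rewrite e //.
rewrite big_split /=.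
have -> : \sum_(i in X | i != x) adjacent G x i =
    #|[set y in X | adjacent G x y]|.
  rewrite -sum1_card big_mkcond [RHS]big_mkcond; apply: eq_bigr => i _.
  rewrite inE; have [->|ne] := eqVneq i x; first by rewrite adjacentxx !andbF.
  by rewrite andbT; case: (i \in X) => //=; case: (adjacent _ _ _).
have -> : \sum_(i in X | i != x) #|[set y in X :\ x | adjacent G i y]| =
    \sum_(i in X :\ x) #|[set y in X :\ x | adjacent G i y]|.
  by apply: eq_bigl => i; rewrite !inE andbC.
by rewrite (cardsD1 x X) xX; lia.
Qed.

End Forests.

(** * Bounded density in terms of component sizes *)

Section Density.
Variables (T : finType) (G : graph T) (tau : rat).
Implicit Types (S : {set T}).
Hypothesis tau0 : (0 <= tau)%R.

Let a := `|numq tau|%N.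
Let b := `|denq tau|%N.

Lemma density_le (H : graph T) :
  (density H <= tau)%R = (#|edges H| * b <= a * #|verts H|).
Proof.
have b0 : 0 < b by rewrite absz_gt0 denq_neq0.
have tE : tau = (a%:R / b%:R)%R.
  rewrite -[LHS]divq_num_den /a /b; congr (_ / _)%R.
    by rewrite -[in LHS](gez0_abs (_ : (0 <= numq tau)%R)) ?numq_ge0.
  by rewrite -[in LHS](gez0_abs (_ : (0 <= denq tau)%R)) ?denq_ge0.
rewrite /density {1}tE.
(* Without vertices there are no edges, and the density [0 / 0 = 0] is at most [tau]. *)
have [v0|v0] := posnP #|verts H|.
  have -> : #|edges H| = 0.
    apply/eqP; rewrite cards_eq0; apply/set0Pn=> -[e eH].
    have := subset_leq_card (edge_verts eH).
    by rewrite (card_edge eH) v0.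
  by rewrite v0 mul0r divr_ge0 ?ler0n.
rewrite ler_pdivrMr ?ltr0n // mulrAC ler_pdivlMr ?ltr0n //.
by rewrite -!natrM ler_nat.
Qed.

Lemma max_density_leP S :
  reflect (forall H, subgraph H (delete G S) -> #|edges H| * b <= a * #|verts H|)
    (max_density (delete G S) <= tau)%R.
Proof.
apply: (iffP (bigmax_leP _ _ _ _)) => [[_ K] H HG|K].
  by rewrite -density_le K.
by split=> // H HG; rewrite density_le K.
Qed.

(* A tree on h vertices has density (h - 1) / h; the inequality below is
   (h - 1) / h <= tau without denominators and without subtraction. *)
Definition within_bound (B : nat) :=
  forall h, 0 < h <= #|T| -> (h <= B) = (h * b <= h * a + b).

Variable B : nat.
Hypothesis hB : within_bound B.

(** A labelling that is constant along the surviving edges certifies [S]: every edge of [H] lies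
    inside one class, and a class meeting [H] in h > 0 vertices spans at most h - 1 edges, where h
    is at most [B]. Summing over the classes gives the bound. *)
Lemma labelling_max_density S (L : T -> T) : acyclic G ->
    (forall x y, adjacent G x y -> x \notin S -> y \notin S -> L x = L y) ->
    (forall v, #|[set x | L x == v]| <= B) ->
  (max_density (delete G S) <= tau)%R.
Proof.
move=> acG LS LB; apply/max_density_leP => H /andP[HV HE].
pose C v := [set x in verts H | L x == v].
have eE : edges H \subset \bigcup_v (edges_in G (C v) :&: edges H).
  apply/subsetP=> e eH; have := subsetP HE _ eH.
  rewrite inE => /andP[eG eS]; have [x [y [xy exy]]] := edgeP eG.
  have [xe ye] : x \in e /\ y \in e by rewrite exy !inE !eqxx orbT.
  have Lxy : L x = L y.
    by apply: (LS _ _ xy); rewrite (disjointFr eS).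
  apply/bigcupP; exists (L x) => //; rewrite inE eH inE eG andbT /=.
  have eV := subsetP (edge_verts eH).
  apply/subsetP=> z ze; rewrite inE eV //=; move: ze.
  by rewrite exy !inE => /orP[]/eqP->; rewrite -?Lxy.
have /leq_trans := subset_leq_card eE.
move/(_ (\sum_v #|edges_in G (C v) :&: edges H|)).
have -> : #|\bigcup_v (edges_in G (C v) :&: edges H)| <=
    \sum_v #|edges_in G (C v) :&: edges H|.
  elim/big_rec2: _ => [|v m X _ Xm]; first by rewrite cards0.
  by apply: leq_trans (leq_card_setU _ _) _; rewrite leq_add2l.
move/(_ isT) => lE.
have vE : #|verts H| = \sum_v #|C v|.
  rewrite -sum1_card (partition_big L xpredT) //=.
  by apply: eq_bigr => v _; rewrite -sum1_card; apply: eq_bigl => x; rewrite inE.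
apply: leq_trans (leq_mul lE (leqnn b)) _.
rewrite vE big_distrl big_distrr leq_sum //= => v _.
have [C0|C0] := eqVneq (C v) set0.
  rewrite (_ : edges_in _ _ :&: _ = set0) ?cards0 //.
  apply/setP=> e; rewrite !inE C0 subset0; apply/negP=> /andP[/andP[eG /eqP e0] _].
  by have := card_edge eG; rewrite e0 cards0.
have h0 : 0 < #|C v| <= #|T| by rewrite card_gt0 C0 max_card.
have := hB h0; rewrite (leq_trans _ (LB v)); last first.
  by apply: subset_leq_card; apply/subsetP=> x; rewrite !inE => /andP[].
move/esym=> hv; have := acyclic_card_edges_in acG C0.
have := subset_leq_card (subsetIl (edges_in G (C v)) (edges H)).
move: #|_ :&: _| #|edges_in _ _| #|C v| hv => e1 e2 h hv le1 le2.
have : e1.+1 * b <= h * b by rewrite leq_mul2r; lia.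
by rewrite mulSn; lia.
Qed.

(** If [S] missed [C], the subgraph induced by [C] would survive; with more than [B] vertices and at
    least [#|C| - 1] edges it is too dense. *)
Lemma max_density_hit S (C : {set T}) : verts G = [set: T] ->
    (max_density (delete G S) <= tau)%R ->
    #|C| <= #|edges_in G C|.+1 -> B < #|C| -> exists2 x, x \in S & x \in C.
Proof.
move=> VG /max_density_leP dS eC BC.
have [|dCS] := boolP [exists x in S, x \in C]; first by case/exists_inP=> x; exists x.
have gH : is_graph (C, edges_in G C).
  by apply/forall_inP=> e; rewrite inE => /andP[/card_edge-> ->].
pose H : graph T := exist (fun VE => is_graph VE) _ gH.
have CS x : x \in C -> x \notin S.
  move=> xC; apply: contra dCS => xS; apply/exists_inP; exists x => //.
have sH : subgraph H (delete G S).
  apply/andP; split; apply/subsetP=> x.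
    by rewrite !inE VG inE andbT => /CS.
  rewrite !inE => /andP[-> xC] /=; rewrite disjoint_subset.
  by apply/subsetP=> y /(subsetP xC)/CS.
have h0 : 0 < #|C| <= #|T| by rewrite (leq_ltn_trans _ BC) // max_card.
have := hB h0; rewrite leqNgt BC /= => /esym/negbT; rewrite -ltnNge.
have : #|edges_in G C| * b <= a * #|C| := dS H sH.
have : #|C| * b <= #|edges_in G C|.+1 * b by rewrite leq_mul2r eC orbT.
by rewrite mulSn; move: #|C| #|_| => h e; lia.
Qed.

End Density.

(** * Correctness and optimality of the greedy elimination *)

Section Elimination.
Variables (T : finType) (G : graph T) (B : nat).
Implicit Types (x y u v p : T) (P D : {set T}) (L : T -> T).

Definition class L v : {set T} := [set x | L x == v].

Definition relabel u p L : T -> T := fun x => if L x == u then p else L x.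

Lemma class_relabel u p L v : u != p -> class (relabel u p L) v =
  if v == u then set0 else if v == p then class L u :|: class L p else class L v.
Proof.
move=> up; apply/setP=> x.
have [Lu|Lu] := eqVneq (L x) u; rewrite inE /relabel ?Lu ?eqxx ?(negbTE Lu).
  have [->|vu] := eqVneq v u; first by rewrite inE eq_sym (negbTE up).
  have [_|vp] := eqVneq v p; first by rewrite !inE Lu !eqxx.
  by rewrite inE Lu eq_sym (negbTE vu).
have [->|vu] := eqVneq v u; first by rewrite inE (negbTE Lu).
by have [->|vp] := eqVneq v p; rewrite !inE // (negbTE Lu).
Qed.

Lemma card_class_merge L u p : u != p ->
  #|class L u :|: class L p| = #|class L u| + #|class L p|.
Proof.
move=> up; rewrite cardsU (_ : _ :&: _ = set0) ?cards0 ?subn0 //.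
by apply/setP=> x; rewrite !inE; case: eqP => //= ->; apply: negbTE.
Qed.

(* State of the greedy algorithm: P is the set of eliminated vertices and D the
   set of deleted ones.  The classes of K are the components built so far, of
   size at most B.  The classes of L also record the merge that caused each
   deletion, so that those of the deleted vertices are disjoint connected sets
   with more than B vertices. *)
Record greedy_state P D K L : Prop := GreedyState {
  greedy_top v : v \notin P -> K v = v;
  greedy_same v : v \notin P -> v \notin D -> class L v = class K v;
  greedy_small v : #|class K v| <= B;
  greedy_dense v : #|class L v| <= #|edges_in G (class L v)|.+1;
  greedy_large v : v \in D -> B < #|class L v|;
  greedy_edge x y : adjacent G x y -> x \in P -> x \notin D -> y \notin D ->
    K x = K y }.

Lemma greedy_init : 0 < B -> greedy_state set0 set0 id id.
Proof.
have c1 v : class id v = [set v] by apply/setP=> x; rewrite !inE.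
by move=> B0; split=> // [v|v|v|x y _]; rewrite ?c1 ?cards1 ?inE.
Qed.

(** The two classes are disjoint, hence so are their edge sets, and the edge joining [u] and [p] is
    in neither. This is why merging preserves [greedy_dense]. *)
Lemma edges_in_merge L u p : u != p -> adjacent G u p -> L u = u -> L p = p ->
  #|edges_in G (class L u)| + #|edges_in G (class L p)| <
  #|edges_in G (class L u :|: class L p)|.
Proof.
move=> up aup Lu Lp.
have dis : [disjoint edges_in G (class L u) & edges_in G (class L p)].
  apply/pred0P=> e /=; rewrite !inE; apply/negP=> /andP[/andP[eG eu] /andP[_ ep]].
  have [x [y [_ exy]]] := edgeP eG.
  have xe : x \in e by rewrite exy !inE eqxx.
  have := subsetP eu _ xe; have := subsetP ep _ xe; rewrite !inE => /eqP->.
  by rewrite eq_sym (negbTE up).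
move: (leq_card_setU (edges_in G (class L u)) (edges_in G (class L p))).
rewrite dis => /leqifP/eqP <-.
apply: proper_card; apply/properP; split.
  apply/subsetP=> e; rewrite !inE => /orP[]/andP[-> es]; apply: (subset_trans es).
    exact: subsetUl.
  exact: subsetUr.
exists [set u; p].
  rewrite inE [_ \in edges G]aup; apply/subsetP=> x.
  by rewrite !inE => /orP[]/eqP->; rewrite ?Lu ?Lp eqxx ?orbT.
rewrite !inE negb_or !negb_and; apply/andP; split; apply/orP; right; apply/negP.
  by move/subsetP/(_ p); rewrite !inE eqxx orbT Lp eq_sym (negbTE up) => /(_ isT).
by move/subsetP/(_ u); rewrite !inE eqxx Lu (negbTE up) => /(_ isT).
Qed.

Section Step.
Variables (P D : {set T}) (K L : T -> T) (u p : T).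
Hypothesis st : greedy_state P D K L.
Hypotheses (uP : u \notin P) (pP : p \notin P) (up : adjacent G u p).
Hypothesis uN : forall y, adjacent G u y -> y \notin P -> y = p.

Let neq_up : u != p.
Proof. by apply: contraTneq up => ->; rewrite adjacentxx. Qed.

(** A deleted end makes the edge between [u] and [p] harmless, and every other neighbour of [u] is
    already eliminated, so that [greedy_edge] covers it from the other side. *)
Lemma greedy_skip : (u \in D) || (p \in D) -> greedy_state (u |: P) D K L.
Proof.
move=> upD; case: st => top same small dense large edge; split=> //.
- by move=> v; rewrite !inE negb_or => /andP[_]; apply: top.
- by move=> v; rewrite !inE negb_or => /andP[_]; apply: same.
- move=> x y xy; rewrite !inE => /orP[/eqP xu|]; last exact: edge.
  rewrite {x}xu in xy *; move=> uD yD.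
  have [yP|yP] := boolP (y \in P); first by rewrite (edge y u) // adjacentC.
  by move: upD; rewrite (negbTE uD) -(uN xy yP) (negbTE yD).
Qed.

Hypotheses (uD : u \notin D) (pD : p \notin D).

Let Lu : L u = u.
Proof.
have : u \in class K u by rewrite inE (greedy_top st uP).
by rewrite -(greedy_same st) // inE => /eqP.
Qed.

Let Lp : L p = p.
Proof.
have : p \in class K p by rewrite inE (greedy_top st pP).
by rewrite -(greedy_same st) // inE => /eqP.
Qed.

Let relabel_dense v : #|class (relabel u p L) v| <=
  #|edges_in G (class (relabel u p L) v)|.+1.
Proof.
rewrite class_relabel //; case: eqP => _; first by rewrite cards0.
case: eqP => _; last exact: (greedy_dense st).
rewrite card_class_merge //; have := edges_in_merge neq_up up Lu Lp.
by have := greedy_dense st u; have := greedy_dense st p; lia.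
Qed.

Lemma greedy_merge : #|class K u| + #|class K p| <= B ->
  greedy_state (u |: P) D (relabel u p K) (relabel u p L).
Proof.
move=> leB; case: (st) => top same small dense large edge; split=> //.
- move=> v; rewrite !inE negb_or => /andP[vu vP].
  by rewrite /relabel (top v vP) (negbTE vu).
- move=> v; rewrite !inE negb_or => /andP[vu vP] vD; rewrite !class_relabel //.
  by rewrite !same.
- move=> v; rewrite class_relabel //; case: eqP => _; first by rewrite cards0.
  by case: eqP => _ //; rewrite card_class_merge.
- move=> v vD; rewrite class_relabel //.
  have [vu|_] := eqVneq v u; first by rewrite vu (negbTE uD) in vD.
  have [vp|_] := eqVneq v p; first by rewrite vp (negbTE pD) in vD.
  exact: large.
- move=> x y xy; rewrite !inE => /orP[/eqP xu|xP xD yD]; last first.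
    by rewrite /relabel (edge x y).
  rewrite {x}xu in xy *; move=> _ yD.
  have [yP|yP] := boolP (y \in P); first by rewrite /relabel (edge y u) // adjacentC.
  by rewrite (uN xy yP) /relabel !top // eqxx eq_sym (negbTE neq_up).
Qed.

(** Only [L] merges the two classes: the result, with more than [B] vertices, justifies deleting
    [p], while the classes of [K] keep their sizes. *)
Lemma greedy_delete : B < #|class K u| + #|class K p| ->
  greedy_state (u |: P) (p |: D) K (relabel u p L).
Proof.
move=> ltB; case: (st) => top same small dense large edge; split=> //.
- by move=> v; rewrite !inE negb_or => /andP[_]; apply: top.
- move=> v; rewrite !inE !negb_or => /andP[vu vP] /andP[vp vD].
  by rewrite class_relabel // (negbTE vu) (negbTE vp) same.
- move=> v; rewrite !inE class_relabel // => /predU1P[->|vD].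
    by rewrite eq_sym (negbTE neq_up) eqxx card_class_merge // !same.
  have [vu|_] := eqVneq v u; first by rewrite vu (negbTE uD) in vD.
  have [vp|_] := eqVneq v p; first by rewrite vp (negbTE pD) in vD.
  exact: large.
- move=> x y xy; rewrite !inE !negb_or => /orP[/eqP xu|xP] /andP[xp xD] /andP[yp yD];
    last exact: edge.
  rewrite {x}xu in xy xp xD *.
  have [yP|yP] := boolP (y \in P); first by rewrite (edge y u) // adjacentC.
  by rewrite (uN xy yP) eqxx in yp.
Qed.

End Step.

(** When no remaining vertex is a leaf, the forest has no remaining edge. Then [D] is a solution by
    the labelling [K], and an optimal one: every solution meets the class under [L] of each vertex
    of [D], and these classes are disjoint. *)
Lemma greedy_decides P D K L k tau : (0 <= tau)%R -> within_bound T tau B ->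
    verts G = [set: T] -> acyclic G ->
    greedy_state P D K L ->
    (forall v, v \notin P -> #|[set y | adjacent G v y & y \notin P]| != 1) ->
  (#|D| <= k) <-> bounded_density_vertex_deletion G k tau.
Proof.
move=> tau0 hB VG acG [top same small dense large edge] deg.
have done x y : adjacent G x y -> (x \in P) || (y \in P).
  move=> xy; apply/negPn/negP; rewrite negb_or => /andP[xP yP].
  (* A leaf of this set of non-isolated remaining vertices would have exactly one remaining
     neighbour. *)
  pose X := [set v | (v \notin P) && [exists z, adjacent G v z && (z \notin P)]].
  have X0 : X != set0.
    by apply/set0Pn; exists x; rewrite inE xP; apply/existsP; exists y; rewrite xy.
  have [v] := acyclic_leaf acG X0; rewrite inE => /andP[vP /existsP[z /andP[vz zP]]].
  have -> : [set y in X | adjacent G v y] = [set y | adjacent G v y & y \notin P].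
    apply/setP=> t; rewrite !inE andbC; case vt: (adjacent G v t) => //=.
    case: (t \notin P) => //=; apply/existsP; exists v.
    by rewrite adjacentC vt.
  have := deg v vP; rewrite leq_eqVlt => /negbTE-> /=; rewrite ltnS leqn0 cards_eq0.
  by move/eqP/setP/(_ z); rewrite !inE vz zP.
split=> [Dk|[S [_ Sk dS]]].
  exists D; rewrite VG subsetT; split=> //.
  apply: (labelling_max_density (L := K) tau0 hB acG) => // x y xy xD yD.
  case/orP: (done x y xy) => [xP|yP]; first exact: edge.
  by apply/esym/edge => //; rewrite adjacentC.
(* The image of [S] under [L] contains [D]. *)
apply: leq_trans Sk; apply: leq_trans (leq_imset_card L S).
apply: subset_leq_card; apply/subsetP=> v vD.
have [x xS] := max_density_hit tau0 hB VG dS (dense v) (large v vD).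
by rewrite inE => /eqP Lx; apply/imsetP; exists x.
Qed.

End Elimination.

(** * Symbolic execution of word RAM programs *)

Section RunRules.
Variables (w : nat) (P : program) (A : Prop).
Implicit Types (rs : seq nat) (M : nat -> nat).

Lemma run_eq t pc R R' M M' : R =1 R' -> M =1 M' ->
  run w P t pc R M = run w P t pc R' M'.
Proof.
have upd f g i x : f =1 g -> update f i x =1 update g i x.
  by move=> fg j; rewrite /update fg.
elim: t pc R R' M M' => //= t IH pc R R' M M' eR eM.
case: (onth P pc) => // -[r a|r s u|r s u|r s|r s|l|r s l||] //; rewrite ?eR ?eM.
- by apply: IH => //; apply: upd.
- by apply: IH => //; apply: upd.
- by apply: IH => //; apply: upd.
- by apply: IH => //; apply: upd.
- by apply: IH => //; apply: upd.
- exact: IH.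
- exact: IH.
Qed.

Lemma run_leq t t' pc R M ans : t <= t' ->
  run w P t pc R M = Some ans -> run w P t' pc R M = Some ans.
Proof.
elim: t t' pc R M => // t IH [//|t'] pc R M tt' /=.
by case: (onth P pc) => // -[r a|r s u|r s u|r s|r s|l|r s l||] //; apply: IH.
Qed.

(** Registers are a list padded with zeros, so that their contents compute by simplification during
    symbolic execution. *)
Definition answers t pc rs M : Prop :=
  exists ans : bool, run w P t pc (nth 0 rs) M = Some ans /\ (ans <-> A).

Lemma answers_leq t t' pc rs M : t <= t' ->
  answers t pc rs M -> answers t' pc rs M.
Proof. by move=> tt' [ans [/(run_leq tt') H ?]]; exists ans. Qed.

Lemma answers_update t pc rs r x M : answers t pc (set_nth 0 rs r x) M ->
  exists ans : bool,
    run w P t pc (update (nth 0 rs) r x) M = Some ans /\ (ans <-> A).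
Proof.
case=> ans [H ?]; exists ans; split=> //; rewrite -H; apply: run_eq => // j.
by rewrite nth_set_nth.
Qed.

(** This rule and the following ones execute one instruction each. The side conditions of the
    arithmetic ones exclude overflow, which turns modular arithmetic into that of [nat]. *)
Lemma answers_const r a t pc rs M : onth P pc = Some (Const r a) ->
  a < 2 ^ w -> answers t pc.+1 (set_nth 0 rs r a) M -> answers t.+1 pc rs M.
Proof. by move=> Pi lt; rewrite /answers /= Pi modn_small //; exact: answers_update. Qed.

Lemma answers_add r s u t pc rs M : onth P pc = Some (Add r s u) ->
  nth 0 rs s + nth 0 rs u < 2 ^ w ->
  answers t pc.+1 (set_nth 0 rs r (nth 0 rs s + nth 0 rs u)) M ->
  answers t.+1 pc rs M.
Proof. by move=> Pi lt; rewrite /answers /= Pi modn_small //; exact: answers_update. Qed.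

Lemma answers_sub r s u t pc rs M : onth P pc = Some (Defs.Sub r s u) ->
  nth 0 rs u <= nth 0 rs s < 2 ^ w ->
  answers t pc.+1 (set_nth 0 rs r (nth 0 rs s - nth 0 rs u)) M ->
  answers t.+1 pc rs M.
Proof.
move=> Pi /andP[le lt]; rewrite /answers /= Pi.
have -> : nth 0 rs s + (2 ^ w - nth 0 rs u) = nth 0 rs s - nth 0 rs u + 2 ^ w by lia.
by rewrite modnDr modn_small; [exact: answers_update|lia].
Qed.

Lemma answers_read r s t pc rs M : onth P pc = Some (Read r s) ->
  answers t pc.+1 (set_nth 0 rs r (M (nth 0 rs s))) M -> answers t.+1 pc rs M.
Proof. by move=> Pi; rewrite /answers /= Pi; exact: answers_update. Qed.

Lemma answers_write r s t pc rs M : onth P pc = Some (Write r s) ->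
  answers t pc.+1 rs (update M (nth 0 rs r) (nth 0 rs s)) -> answers t.+1 pc rs M.
Proof. by move=> Pi; rewrite /answers /= Pi. Qed.

Lemma answers_jump l t pc rs M : onth P pc = Some (Jump l) ->
  answers t l rs M -> answers t.+1 pc rs M.
Proof. by move=> Pi; rewrite /answers /= Pi. Qed.

Lemma answers_jumplt r s l t pc rs M : onth P pc = Some (JumpLt r s l) ->
  answers t (if nth 0 rs r < nth 0 rs s then l else pc.+1) rs M ->
  answers t.+1 pc rs M.
Proof. by move=> Pi; rewrite /answers /= Pi. Qed.

Lemma answers_accept t pc rs M : onth P pc = Some Accept -> A ->
  answers t.+1 pc rs M.
Proof. by move=> Pi a; exists true; rewrite /= Pi. Qed.

Lemma answers_reject t pc rs M : onth P pc = Some Reject -> ~ A ->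
  answers t.+1 pc rs M.
Proof. by move=> Pi a; exists false; rewrite /= Pi. Qed.

End RunRules.

(** * The program *)

(* R[0] = 0, R[1] = 1, R[2] = n, R[3] = k, R[4] = b - a, R[5] = b, R[6] = B,
   R[7] = address of the neighbours; R[8], R[9] and R[10] = addresses of the
   arrays of remaining degrees, sums of remaining neighbours and component sizes
   (0 for deleted vertices); R[11] = current vertex, R[12] = number of
   deletions, R[13] = leaf u, R[14] = its neighbour p.  The numbers in the
   comments are the program addresses used by the jumps. *)
Definition tree_program : program :=
 [:: (* 0: n, k and tau = a / b; accept if tau >= 1 *)
     Const 1 1; Read 2 0; Read 3 1; Const 15 2; Read 4 15; Const 15 3;
     Read 5 15; JumpLt 4 5 9; Accept; Defs.Sub 4 5 4; Add 7 4 0;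
     (* 11: R[6] := min(n, b / (b - a)) *)
     JumpLt 5 7 17; JumpLt 6 2 14; Jump 17; Add 6 6 1; Add 7 7 4; Jump 11;
     (* 17: addresses of the arrays *)
     Const 15 5; Add 7 2 15; Defs.Sub 15 7 1; Read 15 15; Add 8 7 15; Add 9 8 2;
     Add 10 9 2; Add 13 7 0;
     (* 25: for each vertex, its degree, the sum of its neighbours, and 1 *)
     JumpLt 11 2 27; Jump 48; Const 15 5; Add 15 15 11; Read 15 15;
     Add 14 15 7; Const 16 0; Const 17 0;
     JumpLt 13 14 35; Jump 40; Read 15 13; Add 17 17 15; Add 16 16 1;
     Add 13 13 1; Jump 33;
     Add 15 8 11; Write 15 16; Add 15 9 11; Write 15 17; Add 15 10 11;
     Write 15 1; Add 11 11 1; Jump 25;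
     (* 48: for each vertex, eliminate the chain of leaves starting there *)
     Const 11 0;
     JumpLt 11 2 53; JumpLt 3 12 52; Accept; Reject; Add 13 11 0;
     (* 54: skip to 83 unless the vertex R[13] is a leaf *)
     Add 15 8 13; Read 16 15; JumpLt 16 1 83; JumpLt 1 16 83; Write 15 0;
     Add 15 9 13; Read 14 15;
     Add 15 8 14; Read 16 15; Defs.Sub 16 16 1; Write 15 16;
     Add 15 9 14; Read 16 15; Defs.Sub 16 16 13; Write 15 16;
     Add 15 10 13; Read 16 15; Add 15 10 14; Read 17 15;
     JumpLt 16 1 78; JumpLt 17 1 78; Add 17 17 16; JumpLt 6 17 80; Write 15 17;
     (* 78: continue with the former neighbour of the leaf *)
     Add 13 14 0; Jump 54;
     (* 80: delete this neighbour *)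
     Write 15 0; Add 12 12 1; Jump 78;
     Add 11 11 1; Jump 49].

Ltac ram_const := apply: answers_const; [reflexivity|rewrite /=; lia|rewrite /=].
Ltac ram_add := apply: answers_add; [reflexivity|rewrite /=; lia|rewrite /=].
Ltac ram_sub := apply: answers_sub; [reflexivity|rewrite /=; lia|rewrite /=].
Ltac ram_read := apply: answers_read; [reflexivity|rewrite /=].
Ltac ram_write := apply: answers_write; [reflexivity|rewrite /=].
Ltac ram_jump := apply: answers_jump; [reflexivity|].
Ltac ram_jumplt := apply: answers_jumplt; [reflexivity|rewrite /=].
Ltac ram_jumplt_true := ram_jumplt; rewrite ifT; [|lia].
Ltac ram_jumplt_false := ram_jumplt; rewrite ifF; [|lia].

Lemma update_same f i x : update f i x i = x.
Proof. by rewrite /update eqxx. Qed.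

Lemma update_other f i x j : j <> i -> update f i x j = f j.
Proof. by rewrite /update; case: eqP. Qed.

(** * Layout of the encoded instance in memory *)

Section Encoding.
Variables (n : nat) (l : 'I_n -> seq 'I_n) (k : nat) (tau : rat).

Let inp := instance_encoding l k tau.

Definition offset i := sumn (take i [seq size (l v) | v <- enum 'I_n]).

Lemma size_map_ord (T : Type) (f : 'I_n -> T) : size (map f (enum 'I_n)) = n.
Proof. by rewrite size_map size_enum_ord. Qed.

Lemma nth_map_ord (T : Type) (x0 : T) (f : 'I_n -> T) (v : 'I_n) :
  nth x0 (map f (enum 'I_n)) v = f v.
Proof. by rewrite (nth_map v) ?size_enum_ord // nth_ord_enum. Qed.

Lemma offsetS (v : 'I_n) : offset v.+1 = offset v + size (l v).
Proof.
by rewrite /offset (take_nth 0) ?size_map_ord // sumn_rcons nth_map_ord.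
Qed.

Lemma offset_leq i j : i <= j -> offset i <= offset j.
Proof.
move=> ij; rewrite /offset -(subnKC ij) takeD sumn_cat; lia.
Qed.

Lemma offset_all : offset n = \sum_(v < n) size (l v).
Proof.
rewrite /offset take_oversize ?size_map_ord //.
by rewrite sumnE big_map big_enum.
Qed.

Let offsets := 0 :: scanl addn 0 [seq size (l v) | v <- enum 'I_n].
Let neighbours := flatten [seq [seq val u | u <- l v] | v <- enum 'I_n].

Let nth_encoding i : nth 0 inp (4 + i) = nth 0 (offsets ++ neighbours) i.
Proof. by []. Qed.

Let size_offsets : size offsets = n.+1.
Proof. by rewrite /= size_scanl size_map_ord. Qed.

Lemma encoding_offset i : i <= n -> nth 0 inp (4 + i) = offset i.
Proof.
move=> le; rewrite nth_encoding nth_cat size_offsets ltnS le /offsets.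
case: i le => [|i] le /=; first by rewrite /offset take0.
rewrite nth_scanl ?size_map_ord // /offset.
by rewrite (foldl_foldr addnA addnC).
Qed.

Lemma encoding_neighbour (v : 'I_n) j : j < size (l v) ->
  nth 0 inp (5 + n + offset v + j) = nth 0 (map val (l v)) j.
Proof.
move=> le.
(* Four header words and [n + 1] offsets precede the neighbours. *)
have -> : 5 + n + offset v + j = 4 + (n.+1 + (offset v + j)) by lia.
rewrite nth_encoding nth_cat size_offsets ltnNge leq_addr /= addKn /neighbours.
pose ss := [seq [seq val u | u <- l v0] | v0 <- enum 'I_n].
have shE : shape ss = [seq size (l v) | v <- enum 'I_n].
  by rewrite /shape /ss -map_comp; apply: eq_map => x /=; rewrite size_map.
have -> : offset v + j = flatten_index (shape ss) v j.
  by rewrite /flatten_index shE.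
rewrite nth_flatten /= flatten_indexKl ?flatten_indexKr //.
- by rewrite /ss nth_map_ord.
- by rewrite shE nth_map_ord.
- by rewrite shE nth_map_ord.
Qed.

Lemma size_encoding : size inp = 5 + n + offset n.
Proof.
have sN : size neighbours = offset n.
  rewrite /neighbours size_flatten /shape -map_comp offset_all sumnE big_map big_enum.
  by apply: eq_bigr => v _; rewrite /= size_map.
have -> : size inp = 4 + size (offsets ++ neighbours) by [].
by rewrite size_cat size_offsets sN; lia.
Qed.

(** [2 ^ input_bits inp] is at least the length of the input plus any entry; the factor 3 raises it
    to its cube, which leaves room for squares. *)
Lemma encoding_leq x w : 3 * input_bits inp <= w -> x \in inp ->
  (size inp + x) ^ 3 <= 2 ^ w.
Proof.
move=> bw xi; apply: leq_trans (leq_pexp2l _ bw) => //.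
rewrite mulnC expnM leq_exp2r //.
apply: leq_trans (up_logP _ _) => //; rewrite leq_add2l.
by rewrite (big_rem x xi) /= leq_max leqnn.
Qed.

End Encoding.

(** * Verification and running time of the program *)

Section Verification.
Variables (n : nat) (G : graph 'I_n) (l : 'I_n -> seq 'I_n) (k : nat).
Variables (tau : rat) (w : nat).
Hypothesis VG : verts G = [set: 'I_n].
Hypothesis acG : acyclic G.
Hypothesis n_gt0 : 0 < n.
Hypothesis lG : adjacency_lists G l.
Hypothesis tau_ge0 : (0 <= tau)%R.

Let a := `|numq tau|%N.
Let b := `|denq tau|%N.
Let m := offset l n.
Let inp := instance_encoding l k tau.

(** Absence of overflow: the accumulator in the computation of [B] stays within [2 * b], the last
    array ends at [5 + 4 * n + m], and a sum of neighbours is at most [n * n]. *)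
Hypothesis word_k : k < 2 ^ w.
Hypothesis word_a : a < 2 ^ w.
Hypothesis word_b : 2 * b < 2 ^ w.
Hypothesis word_addr : 5 + 4 * n + m < 2 ^ w.
Hypothesis word_sum : n * n < 2 ^ w.

Let answer := bounded_density_vertex_deletion G k tau.
Let ans := answers w tree_program answer.

Let Nb := 5 + n.
Let Dg := Nb + m.
Let Sm := Dg + n.
Let Sz := Sm + n.

Section Arrays.
Variable B : nat.
Hypothesis B_gt0 : 0 < B <= n.
Hypothesis hB : within_bound 'I_n tau B.

Let regs i c u p t x y :=
  [:: 0; 1; n; k; b - a; b; B; Nb; Dg; Sm; Sz; i; c; u; p; t; x; y].

Definition rest (P : {set 'I_n}) (v : 'I_n) : {set 'I_n} :=
  [set y | adjacent G v y & y \notin P].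

(** An eliminated vertex has stored degree 0, so it is never mistaken for a leaf; its sum and size
    are left unspecified. *)
Record represents (P D : {set 'I_n}) (K : 'I_n -> 'I_n) (M : nat -> nat) : Prop :=
  Represents {
    repr_deg (v : 'I_n) : M (Dg + v) = if v \in P then 0 else #|rest P v|;
    repr_sum (v : 'I_n) : v \notin P -> M (Sm + v) = \sum_(y in rest P v) y;
    repr_size (v : 'I_n) : v \notin P -> M (Sz + v) = if v \in D then 0 else #|class K v| }.

(** By symmetry of adjacency, [p] is the only remaining vertex that has [u] among its remaining
    neighbours. *)
Lemma rest_eliminate P u p v : rest P u = [set p] -> u \notin P -> v \notin P ->
  rest (u |: P) v = if v == p then rest P v :\ u else rest P v.
Proof.
move=> restu uP vP; have upd : rest (u |: P) v = rest P v :\ u.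
  by apply/setP=> z; rewrite !inE negb_or andbCA.
rewrite upd; case: (eqVneq v p) => // vp; apply/setDidPl.
rewrite disjoint_sym disjoints1 inE uP andbT adjacentC.
have : v \in rest P u = false by rewrite restu inE (negbTE vp).
by rewrite inE vP andbT => ->.
Qed.

Lemma rest_adjacent P u p : rest P u = [set p] -> u \notin P ->
  [/\ adjacent G u p, p \notin P, u \in rest P p &
      forall y, adjacent G u y -> y \notin P -> y = p].
Proof.
move=> restu uP; have : p \in rest P u by rewrite restu set11.
rewrite inE => /andP[up pP]; split=> //; first by rewrite inE adjacentC up.
move=> y uy yP; have : y \in rest P u by rewrite inE uy.
by rewrite restu inE => /eqP.
Qed.

Lemma rest_sum_leq P v : \sum_(y in rest P v) y <= n * n.
Proof.
apply: (@leq_trans (\sum_(y : 'I_n) n)).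
  by rewrite big_mkcond leq_sum // => y _; case: ifP => // _; apply: ltnW.
by rewrite big_const_ord iter_addn_0.
Qed.

Lemma represents_eliminate P D K M M' (D' : {set 'I_n}) K' u p :
    rest P u = [set p] -> u \notin P ->
    represents P D K M ->
    (forall v : 'I_n, M' (Dg + v) = if v == u then 0 else
       if v == p then (M (Dg + p)).-1 else M (Dg + v)) ->
    (forall v : 'I_n, M' (Sm + v) =
       if v == p then M (Sm + p) - u else M (Sm + v)) ->
    (forall v : 'I_n, v \notin P -> v != u ->
       M' (Sz + v) = if v \in D' then 0 else #|class K' v|) ->
  represents (u |: P) D' K' M'.
Proof.
move=> restu uP [deg sum size] deg' sum' size'.
have [up pP urest _] := rest_adjacent restu uP.
split=> v.
- rewrite deg' inE in_set1; case: eqP => //= _.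
  have [vp|vp] := eqVneq v p.
    rewrite vp deg (negbTE pP) (rest_eliminate restu) // eqxx.
    by rewrite (cardsD1 u (rest P p)) urest.
  by rewrite deg; case: ifP => // vP; rewrite (rest_eliminate restu) ?vP // (negbTE vp).
- rewrite !inE negb_or => /andP[vu vP]; rewrite sum' (rest_eliminate restu) //.
  have [vp|vp] := eqVneq v p; last exact: sum.
  rewrite vp sum // (big_setD1 u) //= addKn.
  by apply: eq_bigl => z; rewrite !inE andbC.
- by rewrite !inE negb_or => /andP[vu vP]; apply: size'.
Qed.

(** A starting vertex costs 8 steps outside the eliminations, an elimination at most 28, paid by the
    shrinking of [~: P], and the end 3; the total is linear however long the chains are. No leaf is
    left behind: among the remaining vertices, eliminating [u] changes the degree of [p] only, and
    the chain continues at [p]. *)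
Lemma elimination_loop i c P (D : {set 'I_n}) K L M u p t x y :
    i <= n -> c = #|D| -> greedy_state G B P D K L -> represents P D K M ->
    (forall v : 'I_n, v < i -> v \notin P -> #|rest P v| != 1) ->
  ans (28 * #|~: P| + 8 * (n - i) + 3) 49 (regs i c u p t x y) M.
Proof.
move: {2}(n - i) (erefl (n - i)) => d.
elim: d i c P D K L M u p t x y => [|d IHd] i c P D K L M u p t x y dE le_in cE st rep deg.
  have {}dE : i = n by lia.
  have [acc rej] : (c <= k -> answer) /\ (answer -> c <= k).
    rewrite cE; apply/(greedy_decides k tau_ge0 hB VG acG st) => v; apply: deg.
    by rewrite dE.
  apply: (@answers_leq _ _ _ 3); first lia.
  ram_jumplt_false; ram_jumplt; case: ltnP => Dk.
    by apply: answers_reject => // /rej; rewrite leqNgt Dk.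
  by apply: answers_accept => //; apply: acc.
have lt_in : i < n by lia.
apply: (@answers_leq _ _ _ (28 * #|~: P| + 8 * d + 9).+2); first lia.
ram_jumplt_true; ram_add; rewrite addn0.
(* Along a chain, the current vertex is the only one up to [i] that may be a leaf. *)
suff inner (u0 : 'I_n) p0 t0 x0 y0 :
    (forall v : 'I_n, v <= i -> v != u0 -> v \notin P -> #|rest P v| != 1) ->
    ans (28 * #|~: P| + 8 * d + 9) 54 (regs i c u0 p0 t0 x0 y0) M.
  apply: (inner (Ordinal lt_in)) => v le_vi ne_vi; apply: deg.
  rewrite ltn_neqAle le_vi andbT.
  by apply: contra ne_vi => /eqP e; apply/eqP/val_inj.
move: {2}#|~: P| (erefl #|~: P|) => q {deg le_in u p t x y}.
elim/ltn_ind: q c P D K L M u0 p0 t0 x0 y0 cE st rep =>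
  q IHq c P D K L M u p t x y cE st rep qE deg.
have ltu := ltn_ord u.
have [degu|degu] := eqVneq (M (Dg + u)) 1; last first.
  have exit p1 t1 x1 y1 :
      ans (28 * q + 8 * d + 3).+2 83 (regs i c u p1 t1 x1 y1) M.
    ram_add; ram_jump; rewrite addn1 -qE (_ : d = n - i.+1); last lia.
    apply: (IHd i.+1 c P D K L M) => //; first lia.
    move=> v le_vi vP; have [vu|vu] := eqVneq v u; last exact: deg.
    by move: degu; rewrite -vu (repr_deg rep) (negbTE vP).
  apply: (@answers_leq _ _ _ (28 * q + 8 * d + 3).+2.+4); first lia.
  ram_add; ram_read; ram_jumplt; case: ltnP => M1.
    by apply: answers_leq (exit _ _ _ _); lia.
  by ram_jumplt_true; apply: exit.
have [p' uP restu] : exists2 p', u \notin P & rest P u = [set p'].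
  move: degu; rewrite (repr_deg rep); case: ifP => // uP /eqP/cards1P[p' pE].
  by exists p'; rewrite ?uP.
have [up pP urest uN] := rest_adjacent restu uP.
have ltp := ltn_ord p'.
have neq_up : u != p' by apply: contraTneq up => ->; rewrite adjacentxx.
have neq_addr (v z : 'I_n) : v != z -> (v : nat) <> z.
  by move=> vz /val_inj/eqP; apply/negP.
have neq_val := neq_addr _ _ neq_up.
have q_gt0 : #|~: (u |: P)| < q.
  by rewrite -qE (cardsD1 u (~: P)) inE uP setCU setIC -setDE ltnS.
have sum_u : M (Sm + u) = p' by rewrite (repr_sum rep) // restu big_set1.
have deg_p : 0 < M (Dg + p') <= n.
  rewrite (repr_deg rep) (negbTE pP); apply/andP; split.
    by apply/card_gt0P; exists u.
  by rewrite -[leqRHS]card_ord max_card.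
have sum_p : u <= M (Sm + p') <= n * n.
  rewrite (repr_sum rep) // rest_sum_leq andbT.
  by rewrite (big_setD1 u) //= leq_addr.
have deg' (v : 'I_n) : v <= i -> v != p' -> v \notin u |: P ->
    #|rest (u |: P) v| != 1.
  rewrite !inE negb_or => le_vi vp /andP[vu vP].
  by rewrite (rest_eliminate restu) // (negbTE vp); apply: deg.
set M1 := update (update (update M (Dg + u) 0) (Dg + p') (M (Dg + p')).-1)
            (Sm + p') (M (Sm + p') - u).
(* All outcomes meet at address 78 after at most 26 instructions; from there the induction
   hypothesis applies to [p'], with one remaining vertex fewer. *)
have step c' (D' : {set 'I_n}) K' L' M' t' x' y' :
    c' = #|D'| -> greedy_state G B (u |: P) D' K' L' ->
    represents (u |: P) D' K' M' ->
    ans (28 * q + 8 * d + 9 - 26) 78 (regs i c' u p' t' x' y') M'.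
  move=> cE' st' rep'.
  apply: (@answers_leq _ _ _ (28 * #|~: (u |: P)| + 8 * d + 9).+2); first lia.
  by ram_add; rewrite addn0; ram_jump; apply: (IHq _ q_gt0 _ _ _ _ _ _ _ _ _ _ _ cE' st' rep').
apply: (@answers_leq _ _ _ (28 * q + 8 * d + 9 - 26).+4.+4.+4.+4.+4.+4.+2); first lia.
ram_add; ram_read; rewrite degu; ram_jumplt; ram_jumplt; ram_write.
ram_add; ram_read; rewrite update_other; last lia.
rewrite sum_u; ram_add; ram_read; rewrite update_other; last lia.
ram_sub; ram_write; rewrite subn1.
ram_add; ram_read; rewrite !update_other; try lia.
ram_sub; ram_write; rewrite -/M1.
have M1deg (v : 'I_n) : M1 (Dg + v) = if v == u then 0 else
    if v == p' then (M (Dg + p')).-1 else M (Dg + v).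
  have ltv := ltn_ord v; rewrite /M1 update_other; last lia.
  have [->|/neq_addr vp] := eqVneq v p'.
    by rewrite update_same eq_sym (negbTE neq_up).
  rewrite update_other; last lia.
  have [->|/neq_addr vu] := eqVneq v u; first by rewrite update_same.
  by rewrite update_other; last lia.
have M1sum (v : 'I_n) : M1 (Sm + v) =
    if v == p' then M (Sm + p') - u else M (Sm + v).
  have ltv := ltn_ord v; rewrite /M1.
  have [->|/neq_addr vp] := eqVneq v p'; first by rewrite update_same.
  by rewrite !update_other; lia.
have M1size (v : 'I_n) : M1 (Sz + v) = M (Sz + v).
  by have ltv := ltn_ord v; rewrite /M1 !update_other; lia.
ram_add; ram_read; rewrite M1size; ram_add; ram_read; rewrite M1size.
have size_u := repr_size rep uP; have size_p := repr_size rep pP.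
have [skip|] := boolP ((u \in D) || (p' \in D)).
  have go t' x' y' : ans (28 * q + 8 * d + 9 - 26) 78 (regs i c u p' t' x' y') M1.
    apply: (step c D K L) => //; first exact: (greedy_skip (p := p') st).
    apply: (represents_eliminate restu uP rep) => // v vP vu.
    by rewrite M1size (repr_size rep).
  ram_jumplt; case: ltnP => Mu; first by apply: answers_leq (go _ _ _); lia.
  ram_jumplt; rewrite ifT; first by apply: answers_leq (go _ _ _); lia.
  rewrite size_p; by case/orP: skip => [uD|->//]; move: Mu; rewrite size_u uD.
rewrite negb_or => /andP[uD pD].
(* A class contains its representative, so among remaining vertices a stored size 0 occurs for
   deleted ones only. *)
have class_bounds v : v \notin P -> 0 < #|class K v| <= B.
  move=> vP; rewrite (greedy_small st) andbT; apply/card_gt0P; exists v.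
  by rewrite inE (greedy_top st vP).
rewrite size_u size_p (negbTE uD) (negbTE pD).
have := class_bounds u uP; have := class_bounds p' pP.
have [su Esu] : exists su, su = #|class K u| by eexists.
have [sp Esp] : exists sp, sp = #|class K p'| by eexists.
rewrite -Esu -Esp => p_bounds u_bounds.
ram_jumplt_false; ram_jumplt_false; ram_add; ram_jumplt; case: ltnP => BM.
  have c_leq : c <= n by rewrite cE -[leqRHS]card_ord max_card.
  ram_write; ram_add; ram_jump.
  apply: answers_leq (step (c + 1) (p' |: D) K (relabel u p' L) _ _ _ _ _ _ _); first lia.
    by rewrite cardsU1 pD cE addnC.
    by apply: (greedy_delete (p := p') st) => //; rewrite addnC -Esu -Esp.
  apply: (represents_eliminate restu uP rep) => [v|v|v vP vu].
  - by have ltv := ltn_ord v; rewrite update_other //; lia.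
  - by have ltv := ltn_ord v; rewrite update_other //; lia.
  - rewrite !inE; have [->|/neq_addr vp] := eqVneq v p'; first by rewrite update_same.
    by rewrite update_other ?M1size ?(repr_size rep) //; lia.
ram_write.
apply: answers_leq (step c D (relabel u p' K) (relabel u p' L) _ _ _ _ _ _ _) => //; first lia.
  by apply: (greedy_merge (p := p') st) => //; rewrite addnC -Esu -Esp.
apply: (represents_eliminate restu uP rep) => [v|v|v vP vu].
- by have ltv := ltn_ord v; rewrite update_other //; lia.
- by have ltv := ltn_ord v; rewrite update_other //; lia.
- rewrite class_relabel // (negbTE vu).
  have [->|/neq_addr vp] := eqVneq v p'.
    by rewrite update_same (negbTE pD) card_class_merge // addnC -Esu -Esp.
  by rewrite update_other ?M1size ?(repr_size rep) //; lia.
Qed.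

Lemma rest_set0 v : rest set0 v =i l v.
Proof. by move=> z; rewrite !inE andbT (proj2 (lG v)). Qed.

Lemma sum_rest_set0 v : sumn (map val (l v)) = \sum_(y in rest set0 v) y.
Proof.
rewrite sumnE big_map big_uniq; last by case: (lG v).
by apply: eq_bigl => z; rewrite rest_set0.
Qed.

Lemma represents_init M :
    (forall v : 'I_n, [/\ M (Dg + v) = size (l v),
       M (Sm + v) = sumn (map val (l v)) & M (Sz + v) = 1]) ->
  represents set0 set0 id M.
Proof.
move=> MI; split=> v; have [degE sumE sizeE] := MI v; have [uniq_l _] := lG v.
- by rewrite inE degE (eq_card (rest_set0 v)) (card_uniqP uniq_l).
- by rewrite sumE sum_rest_set0.
- rewrite inE sizeE => _; rewrite (_ : class _ _ = [set v]) ?cards1 //.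
  by apply/setP=> z; rewrite !inE.
Qed.

(** All writes go to the arrays, which start at [Dg], just past the input. *)
Definition holds_input M := forall i, i < Dg -> M i = nth 0 inp i.

(** In continuation style: [t] steps are assumed to suffice from address 40. The reading pointer
    ends at the start of the next list, so it is never reset between vertices. *)
Lemma row_loop (v : 'I_n) j t r M : j <= size (l v) -> holds_input M ->
    (forall r, ans t 40 (regs v 0 (Nb + offset l v.+1) (Nb + offset l v.+1) r
       (size (l v)) (sumn (map val (l v)))) M) ->
  ans (t + 7 * (size (l v) - j) + 2) 33
    (regs v 0 (Nb + offset l v + j) (Nb + offset l v.+1) r
       j (sumn (take j (map val (l v))))) M.
Proof.
move=> le_j MI fin; have vS := offsetS l v.
have vm : offset l v.+1 <= m by apply: offset_leq.
have nbr i : i < size (l v) -> M (Nb + offset l v + i) = nth 0 (map val (l v)) i.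
  by move=> lt_i; rewrite MI ?encoding_neighbour //; lia.
have sum_leq i : sumn (take i (map val (l v))) <= n * n.
  apply: leq_trans (rest_sum_leq set0 v).
  by rewrite -sum_rest_set0 -[in leqRHS](cat_take_drop i (map val _)) sumn_cat leq_addr.
have := size_map val (l v); move: (map val (l v)) nbr sum_leq fin => ls nbr sum_leq fin szls.
move: {2}(size (l v) - j) (erefl (size (l v) - j)) => d.
elim: d j r le_j => [|d IH] j r le_j dE.
  have jE : j = size (l v) by lia.
  apply: (@answers_leq _ _ _ t.+2); first lia.
  ram_jumplt_false; ram_jump.
  rewrite jE take_oversize ?szls //.
  have -> : Nb + offset l v + size (l v) = Nb + offset l v.+1 by lia.
  exact: fin.
apply: (@answers_leq _ _ _ (t + 7 * (size (l v) - j.+1) + 2).+4.+2); first lia.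
have lt_j : j < size (l v) by lia.
have takeS : sumn (take j.+1 ls) = sumn (take j ls) + nth 0 ls j.
  by rewrite (take_nth 0) ?szls // sumn_rcons.
have := sum_leq j.+1; rewrite takeS => next_leq.
ram_jumplt_true; ram_read; rewrite nbr //.
ram_add; ram_add; ram_add; ram_jump.
have -> : Nb + offset l v + j + 1 = Nb + offset l v + j.+1 by lia.
by rewrite addn1 -takeS; apply: IH => //; lia.
Qed.

(** The cost of reading telescopes: [m - offset l i] neighbours are still unread at vertex [i]. The
    term [28 * n + 8 * n + 4] pays for the elimination that follows. *)
Lemma init_loop i u p t x y M : i <= n -> holds_input M ->
    (forall v : 'I_n, v < i -> [/\ M (Dg + v) = size (l v),
       M (Sm + v) = sumn (map val (l v)) & M (Sz + v) = 1]) ->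
    u = Nb + offset l i ->
  ans (28 * n + 8 * n + 4 + 7 * (m - offset l i) + 17 * (n - i) + 2) 25
    (regs i 0 u p t x y) M.
Proof.
move: {2}(n - i) (erefl (n - i)) => d.
elim: d i u p t x y M => [|d IH] i u p t x y M dE le_in MI init uE.
  have iE : i = n by lia.
  apply: (@answers_leq _ _ _ (28 * n + 8 * n + 3).+3); first lia.
  ram_jumplt_false; ram_jump; ram_const.
  have -> : 28 * n + 8 * n + 3 = 28 * #|~: (set0 : {set 'I_n})| + 8 * (n - 0) + 3.
    by rewrite setC0 cardsT card_ord subn0.
  apply: (@elimination_loop _ _ _ set0 id id) => //.
  - by rewrite cards0.
  - by apply: greedy_init; lia.
  - by apply: represents_init => v; apply: init; rewrite iE.
have lt_in : i < n by lia.
pose v := Ordinal lt_in; have iE : i = v by [].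
have := offsetS l v; rewrite -iE => vS.
have vm : offset l i.+1 <= m by apply: offset_leq.
set T := 28 * n + 8 * n + 4 + 7 * (m - offset l i.+1) + 17 * (n - i.+1) + 2.
apply: (@answers_leq _ _ _ (T.+4.+4 + 7 * (size (l v) - 0) + 2).+4.+3); first lia.
ram_jumplt_true; ram_const; ram_add; ram_read.
(* Cell [5 + i] holds offset number [i + 1], where the list of vertex [i] ends. *)
have -> : 5 + i = 4 + i.+1 by lia.
rewrite MI; last lia.
rewrite encoding_offset //; ram_add; ram_const; ram_const.
have := @row_loop v 0 T.+4.+4 (offset l i.+1) M isT MI.
rewrite take0 addn0 -iE -uE (addnC (offset l i.+1)); apply=> r.
ram_add; ram_write; ram_add; ram_write; ram_add; ram_write; ram_add; ram_jump.
rewrite addn1; apply: IH => //; first lia.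
  by move=> z lt_z; rewrite !update_other ?MI //; lia.
move=> z; rewrite ltnS leq_eqVlt => /orP[/eqP zi|lt_zi].
  have -> : z = v by apply: val_inj.
  split.
  - by rewrite 2?update_other ?update_same //=; lia.
  - by rewrite update_other ?update_same //=; lia.
  - by rewrite update_same.
have ltz := ltn_ord z; have [degE sumE sizeE] := init z lt_zi.
by split; rewrite !update_other //; lia.
Qed.

End Arrays.

(** Repeated addition replaces division: for [a < b], the condition [h * b <= h * a + b] means
    [h * (b - a) <= b], and the loop looks for the largest such [h]. Stopping at [n], the largest
    possible component size, keeps it linear. *)
Lemma bound_loop B t M : B <= n -> B * (b - a) <= b -> a < b ->
    (forall B' acc, B' <= n -> B' * (b - a) <= b -> B' = n \/ b < B'.+1 * (b - a) ->
      ans t 17 [:: 0; 1; n; k; b - a; b; B'; acc; 0; 0; 0; 0; 0; 0; 0; 3; 0; 0] M) ->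
  ans (t + 5 * (n - B) + 3) 11
    [:: 0; 1; n; k; b - a; b; B; B.+1 * (b - a); 0; 0; 0; 0; 0; 0; 0; 3; 0; 0] M.
Proof.
move=> le_B leb ab fin; move: {2}(n - B) (erefl (n - B)) => d.
elim: d B le_B leb => [|d IH] B le_B leb dE.
  have BE : B = n by lia.
  apply: (@answers_leq _ _ _ t.+3); first lia.
  ram_jumplt; case: ltnP => _.
    by apply: answers_leq (fin B _ le_B leb _); [lia|left].
  by ram_jumplt_false; ram_jump; apply: fin => //; left.
apply: (@answers_leq _ _ _ (t + 5 * (n - B.+1) + 3).+4.+1); first lia.
ram_jumplt; case: ltnP => acc_b.
  by apply: answers_leq (fin B _ le_B leb _); [lia|right].
ram_jumplt_true; ram_add; ram_add; ram_jump.
have -> : B.+1 * (b - a) + (b - a) = B.+2 * (b - a) by rewrite addnC -mulSn.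
by rewrite addn1; apply: IH => //; lia.
Qed.

Lemma tree_program_answers : ans (100 * n) 0 (nseq 18 0) (nth 0 inp).
Proof.
have b_gt0 : 0 < b by rewrite absz_gt0 denq_neq0.
have m_leq : m <= 2 * n.
  have := acyclic_sum_degrees acG [set: 'I_n]; rewrite cardsT card_ord.
  apply: leq_trans; rewrite /m offset_all.
  rewrite [leqRHS](eq_bigl xpredT) => [|v]; last by rewrite inE.
  apply: leq_sum => v _; have [uniq_l mem_l] := lG v.
  rewrite -(card_uniqP uniq_l); apply: eq_leq; apply: eq_card => z.
  by rewrite !inE mem_l.
pose T := 28 * n + 8 * n + 4 + 7 * m + 17 * n + 2.
(* With [m <= 2 * n] this is at most [72 * n + 27], below [100 * n] since [n > 0]. *)
apply: (@answers_leq _ _ _ (T.+4.+4 + 5 * (n - 0) + 3).+4.+4.+2).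
  by rewrite /T; lia.
ram_const; ram_read; ram_read; ram_const; ram_read; ram_const; ram_read.
ram_jumplt; case: ltnP => ab; last first.
  (* For [tau >= 1] nothing needs to be deleted: a single class of size [n] is within the bound. *)
  apply: answers_accept => //; exists set0; rewrite sub0set cards0; split=> //.
  have hn : within_bound 'I_n tau n.
    move=> h /andP[_]; rewrite card_ord => -> ; apply/esym.
    by apply: leq_trans (leq_addr _ _); rewrite leq_mul2l ab orbT.
  apply: (labelling_max_density (L := fun=> Ordinal n_gt0) tau_ge0 hn acG) => // v.
  by rewrite -[leqRHS]card_ord max_card.
ram_sub; ram_add; rewrite addn0.
have := @bound_loop 0 T.+4.+4 (nth 0 inp); rewrite mul1n.
apply=> // B acc le_B leb B_max.
(* [B = 0] would require [n = 0] or [b < b - a]. *)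
have B_gt0 : 0 < B <= n by nia.
have hB : within_bound 'I_n tau B.
  move=> h; rewrite card_ord -/a -/b => /andP[h_gt0 h_leq].
  case: leqP => hB; apply/esym; last by apply/negbTE; rewrite -ltnNge; nia.
  by nia.
ram_const; ram_add; ram_sub; ram_read.
have -> : n + 5 - 1 = 4 + n by lia.
rewrite encoding_offset // -/m; ram_add; ram_add; ram_add; ram_add.
rewrite (addnC n 5) addn0.
have := @init_loop B B_gt0 hB 0 Nb 0 m 0 0 (nth 0 inp).
rewrite /offset take0 !subn0 addn0; exact.
Qed.

End Verification.

(** * Word length and constants *)

Theorem theorem15 :
  exists (P : program) (c d : nat),
  forall (n : nat) (G : graph 'I_n) (l : 'I_n -> seq 'I_n) (k : nat)
         (tau : rat) (w : nat),
    verts G = [set: 'I_n] ->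
    is_tree G ->
    adjacency_lists G l ->
    (0 <= tau)%R ->
    d * input_bits (instance_encoding l k tau) <= w ->
    decides_within w P (c * n) (instance_encoding l k tau)
      (bounded_density_vertex_deletion G k tau).
Proof.
exists tree_program, 100, 3 => n G l k tau w VG [[V0 _] acG] lG tau_ge0 word.
have n_gt0 : 0 < n.
  by case/set0Pn: V0 => v _; apply: leq_ltn_trans (ltn_ord v).
(* Here [s] is the length of the input, at least 5 because of the header and the first offset, and
   [x] is an entry; all the conditions against overflow follow. *)
have cube s x : (s + x) ^ 3 <= 2 ^ w -> 5 <= s -> 5 * s + s * s + 2 * x < 2 ^ w.
  by move=> le ge; apply: leq_trans le; rewrite !expnS expn0; nia.
have bound x : x \in instance_encoding l k tau ->
    5 * (5 + n + offset l n) + (5 + n + offset l n) * (5 + n + offset l n) + 2 * x < 2 ^ w.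
  by move=> xin; rewrite -(size_encoding l k tau); apply: cube (encoding_leq word xin) _;
    rewrite size_encoding; lia.
have bk : k < 2 ^ w by have := bound k; rewrite !inE eqxx orbT => /(_ isT); lia.
have ba : `|numq tau|%N < 2 ^ w.
  by have := bound `|numq tau|%N; rewrite !inE eqxx !orbT => /(_ isT); lia.
have bb : 2 * `|denq tau|%N < 2 ^ w.
  by have := bound `|denq tau|%N; rewrite !inE eqxx !orbT => /(_ isT); lia.
have bn := bound n; rewrite !inE eqxx in bn.
have [ans [H ansP]] := tree_program_answers VG acG n_gt0 lG tau_ge0 bk ba bb
  ltac:(by have := bn isT; lia) ltac:(by have := bn isT; nia).
exists ans; split=> //; rewrite -H; apply: run_eq => // i.
by rewrite nth_nseq if_same.
Qed.
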